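(* Let $\alpha,\beta>0$ be real numbers and let $\{s_n\}_{n\ge0}$ be the logarithmically convergent sequence $$s_n=s+\sum_{j=0}^{\infty}\frac{c_j}{(\beta+n)^{\alpha+j}},\qquad n\in\mathbb N_0,\quad c_0\neq0 .$$ Consider the linear sequence transformation $$\Lambda_k^{(n)}(\beta,s_n)=(-1)^k\sum_{j=0}^k(-1)^j\frac{(\beta+n+j)^k}{j!\,(k-j)!}\,s_{n+j}.$$ If $\alpha$ is a positive integer, then for fixed $k\in\mathbb N$ with $k\ge\alpha$ $$\Lambda_k^{(n)}(\beta,s_n)-s=O(n^{-k-1}),\qquad n\to\infty,$$ which shows that $\Lambda_k^{(n)}(\beta,s_n)$ accelerates the convergence of this sequence for sufficiently large $k$. If, however, $\alpha$ is not a positive integer, then $\Lambda_k^{(n)}(\beta,s_n)$ does not accelerate the convergence of this sequence.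
   Context: The series defining $s_n$ is a convergent series with real coefficients $c_j$. For fixed $k\in\mathbb N$, $\Lambda_k^{(n)}$ accelerates the convergence of $\{s_n\}$ if $\lim_{n\to\infty}(\Lambda_k^{(n)}(\beta,s_n)-s)/(s_n-s)=0$. Equivalently $\Lambda_k^{(n)}(\beta,s_n)=\Delta^k[(\beta+n)^ks_n]/k!$ with $\Delta f(n)=f(n+1)-f(n)$; it is the special case $x_n=1/(\beta+n)$ of the Richardson extrapolation scheme. *)

(* Defs.v *)
From HB Require Import structures.
From mathcomp Require Import all_boot all_order all_algebra.
From mathcomp Require Import all_classical all_reals all_analysis.
Set Implicit Arguments.
Unset Strict Implicit.
Unset Printing Implicit Defensive.
Import Order.TTheory GRing.Theory Num.Theory.
Import numFieldNormedType.Exports.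
Local Open Scope classical_set_scope.
Local Open Scope ring_scope.

Definition Lambda (R : realType) (beta : R) (k : nat) (u : nat -> R) (n : nat)
    : R :=
  (-1) ^+ k * \sum_(0 <= j < k.+1)
    (-1) ^+ j * ((beta + n%:R + j%:R) ^+ k / (j`!%:R * (k - j)`!%:R))
    * u (n + j)%N.

(* Division is total with x / 0 = 0; a quotient with [u n = l] for finitely
   many [n] does not affect the limit. *)
Definition accelerates (R : realType) (t u : nat -> R) (l : R) : Prop :=
  (fun n => (t n - l) / (u n - l)) @ \oo --> (0 : R).

(* Main.v *)
Require Import Defs.
From HB Require Import structures.
From mathcomp Require Import all_boot all_order all_algebra.
From mathcomp Require Import all_classical all_reals all_analysis.
From mathcomp Require Import ring lra.
Set Implicit Arguments.
Unset Strict Implicit.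
Unset Printing Implicit Defensive.
Import Order.TTheory GRing.Theory Num.Theory.
Import numFieldNormedType.Exports.
Local Open Scope classical_set_scope.
Local Open Scope ring_scope.

(** Up to the factor [k!], [Lambda beta k] is the [k]-th forward difference of
    [x ^ k * u x] along the points [x = beta + n].  By the mean value theorem
    it multiplies [x^-a] by [(k - a)(k - 1 - a)...(1 - a) / k!], up to a shift
    of [x] by at most [k].  Truncating the series after [2 k + 1] terms leaves
    a remainder so small that even without any cancellation in [Lambda] it is
    of order [x^(-alpha-k-1)].  Hence (Lambda_k s_n - s) / (s_n - s) tends to
    [(k - alpha)...(1 - alpha) / k!], which vanishes exactly when [alpha] is one
    of [1, ..., k]; in that case the factors of [x^(-alpha-j)] also vanish for
    [alpha + j <= k], and the surviving terms are of order [x^(-k-1)]. *)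

(** * Finite differences and the mean value theorem *)

Section FiniteDifference.
Variable R : realType.
Implicit Types (f g : R -> R) (x a : R) (k i n : nat).

(** The falling factorial of a real [a], the coefficient in the [k]-th derivative of [z ^ a]. *)
Definition falling a k : R := \prod_(0 <= l < k) (a - l%:R).

Lemma fallingS a k : falling a k.+1 = falling a k * (a - k%:R).
Proof. by rewrite /falling big_nat_recr. Qed.

Lemma falling_nat_eq0 n k : (n < k)%N -> falling n%:R k = 0.
Proof.
move=> nk; rewrite /falling big_mkord (bigD1 (Ordinal nk))//=.
by rewrite subrr mul0r.
Qed.

Lemma falling_fact k : falling k%:R k = k`!%:R.
Proof.
rewrite -ffactnn ffact_prod natr_prod /falling big_mkord.
by apply: eq_bigr => i _; rewrite natrB// ltnW.
Qed.

(** The [k]-th forward difference with step 1. The exponent [k + j] has the parity of [k - j] and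
    avoids truncated subtraction. *)
Definition fdiff k f x : R :=
  \sum_(0 <= j < k.+1) (-1) ^+ (k + j) * 'C(k, j)%:R * f (x + j%:R).

Lemma fdiff0 f x : fdiff 0 f x = f x.
Proof. by rewrite /fdiff big_nat1 bin0 !mul1r addr0. Qed.

(** Pascal's rule. The extra difference is put inside, so that an induction on [k] can replace the
    function by its first difference. *)
Lemma fdiffS k f x :
  fdiff k.+1 f x = fdiff k (fun y => f (y + 1) - f y) x.
Proof.
have sgn (j : nat) : (-1) ^+ (k.+1 + j.+1) = (-1) ^+ (k + j) :> R.
  by rewrite addSn addnS !exprS !mulN1r opprK.
have sgn' (j : nat) : (-1) ^+ (k + j.+1) = - (-1) ^+ (k + j) :> R.
  by rewrite addnS exprS mulN1r.
rewrite /fdiff.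
under [RHS]eq_bigr do rewrite mulrBr -addrA natr1.
rewrite sumrB [in LHS]big_nat_recl//.
under [X in _ + X]eq_bigr do rewrite sgn binS natrD mulrDr mulrDl.
rewrite big_split/= [X in _ + (X + _)]big_nat_recr//=.
rewrite (bin_small (ltnSn k)) mulr0 mul0r addr0.
rewrite [X in _ = _ - X]big_nat_recl// !bin0 addSn exprS mulN1r !mulNr addr0.
rewrite -[X in _ = _ - (_ + X)]opprK -sumrN.
under [X in _ = _ - (_ - X)]eq_bigr do rewrite sgn' !mulNr opprK.
rewrite !(addr0 x); ring.
Qed.

(** [F] is a chain of successive derivatives. Its first differences [G] form such a chain too, so
    induction reaches [G k y], and the mean value theorem on [[y, y + 1]] turns this into a value of
    [F k.+1]. *)
Lemma fdiff_MVT k (F : nat -> R -> R) x :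
  (forall i (y : R), 0 < y -> is_derive y 1 (F i) (F i.+1 y)) -> 0 < x ->
  exists2 y, x <= y <= x + k%:R & fdiff k (F 0%N) x = F k y.
Proof.
elim: k F x => [|k IH] F x dF x0.
  by exists x; [rewrite addr0 lexx|rewrite fdiff0].
pose G i y := F i (y + 1) - F i y.
have dG i (y : R) : 0 < y -> is_derive y 1 (G i) (G i.+1 y).
  move=> y0; have y10 : 0 < y + 1 by rewrite addr_gt0.
  have := dF i _ y0; have := dF i _ y10 => d1 d2.
  have d3 : is_derive y 1 (F i \o (fun z => z + 1)) (F i.+1 (y + 1) * 1).
    apply: is_derive1_comp.
    exact: is_derive_shift.
  by rewrite mulr1 in d3; apply: is_deriveB.
have [y /andP[xy yk] Gy] := IH G x dG x0.
have y0 : 0 < y by exact: lt_le_trans xy.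
have y01 z : z \in `[y, y + 1] -> 0 < z.
  by rewrite in_itv/= => /andP[yz _]; exact: lt_le_trans yz.
have yy1 : y < y + 1 by rewrite ltrDl.
have [||z zy] := @MVT R (F k) (F k.+1) y (y + 1) yy1.
- by move=> z /subset_itv_oo_cc/y01 /(dF k).
- apply: derivable_within_continuous => z /y01 z0.
  by have [] := dF k z z0.
- rewrite addrAC subrr add0r mulr1 => Fz.
  exists z; last by rewrite fdiffS Gy -Fz.
  move: zy; rewrite in_itv/= => /andP[yz zy1].
  rewrite (le_trans xy (ltW yz))/= (le_trans (ltW zy1))//.
  by rewrite -natr1 addrA lerD2r.
Qed.

Lemma is_derive_falling_powR a i x : 0 < x ->
  is_derive x 1 (fun y => falling a i * y `^ (a - i%:R))
    (falling a i.+1 * x `^ (a - i.+1%:R)).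
Proof.
move=> x0.
have := @is_derive1_powR R (a - i%:R) x x0 => d.
have := @is_deriveZ _ _ _ _ (falling a i) _ _ _ d.
by rewrite fallingS -natr1 opprD addrA -mulrA.
Qed.

Lemma fdiff_powR k a x : 0 < x ->
  exists2 y, x <= y <= x + k%:R &
    fdiff k (fun z => z `^ a) x = falling a k * y `^ (a - k%:R).
Proof.
move=> x0; have [y xy E] := fdiff_MVT k (@is_derive_falling_powR a) x0.
exists y => //; rewrite -E; congr fdiff; apply/funext => z.
by rewrite /falling big_geq// mul1r subr0.
Qed.

End FiniteDifference.

(** * The transformation as a linear operator: powers, constants, crude bounds *)

Section LambdaTheory.
Variable R : realType.
Implicit Types (beta x y a b : R) (u v : nat -> R) (k n : nat).

Lemma gt0_powRD x a b : 0 < x -> x `^ (a + b) = x `^ a * x `^ b.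
Proof. by move=> x0; rewrite powRD// (gt_eqF x0) implybT. Qed.

Lemma eq_fdiff k (f g : R -> R) x :
  (forall y, x <= y -> f y = g y) -> fdiff k f x = fdiff k g x.
Proof. by move=> fg; apply: eq_bigr => j _; rewrite fg// lerDl. Qed.

(** The weights agree because [1 / (j! (k - j)!)] is ['C(k, j) / k!]. *)
Lemma Lambda_fdiff beta k (g : R -> R) n :
  Lambda beta k (fun m => g (beta + m%:R)) n =
  fdiff k (fun z => z ^+ k * g z) (beta + n%:R) / k`!%:R.
Proof.
rewrite /Lambda /fdiff mulr_sumr mulr_suml.
apply: eq_big_nat => j /andP[_]; rewrite ltnS => jk.
rewrite natrD addrA -(bin_fact jk) !natrM exprD.
have j0 : j`!%:R != 0 :> R by rewrite pnatr_eq0 -lt0n fact_gt0.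
have kj0 : (k - j)`!%:R != 0 :> R by rewrite pnatr_eq0 -lt0n fact_gt0.
have bin0 : 'C(k, j)%:R != 0 :> R by rewrite pnatr_eq0 -lt0n bin_gt0.
by field; rewrite j0 kj0 bin0.
Qed.

Lemma LambdaD beta k u v n :
  Lambda beta k (fun m => u m + v m) n = Lambda beta k u n + Lambda beta k v n.
Proof.
rewrite /Lambda -mulrDr -big_split/=; congr (_ * _).
by apply: eq_bigr => j _; rewrite mulrDr.
Qed.

Lemma LambdaZ beta k a u n :
  Lambda beta k (fun m => a * u m) n = a * Lambda beta k u n.
Proof.
rewrite /Lambda mulrCA; congr (_ * _); rewrite mulr_sumr.
by apply: eq_bigr => j _; rewrite mulrCA.
Qed.

Lemma Lambda_sum beta k (F : nat -> nat -> R) J n :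
  Lambda beta k (fun m => \sum_(0 <= j < J) F j m) n =
  \sum_(0 <= j < J) Lambda beta k (F j) n.
Proof.
rewrite /Lambda -mulr_sumr exchange_big/=; congr (_ * _).
by apply: eq_bigr => i _; rewrite mulr_sumr.
Qed.

(** The weight [z ^ k] turns [z ^ (- a)] into [z ^ (k - a)], and the [k]-th difference lowers the
    exponent back to [- a]. *)
Lemma Lambda_powR beta k a n : 0 < beta ->
  exists2 y, beta + n%:R <= y <= beta + n%:R + k%:R &
    Lambda beta k (fun m => (beta + m%:R) `^ (- a)) n =
    falling (k%:R - a) k / k`!%:R * y `^ (- a).
Proof.
move=> beta0; have x0 : 0 < beta + n%:R by rewrite ltr_wpDr.
have [y xy E] := fdiff_powR k (k%:R - a) x0; exists y => //.
rewrite (Lambda_fdiff beta k (fun z => z `^ (- a))).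
rewrite (@eq_fdiff _ _ (fun z => z `^ (k%:R - a))) ?E => [|z xz].
  by rewrite addrAC subrr add0r mulrAC.
have z0 : 0 < z by exact: lt_le_trans xz.
by rewrite gt0_powRD// powR_mulrn// ltW.
Qed.

(** The exponent 0 in [Lambda_powR] gives the coefficient [k! / k! = 1]; linearity does the rest. *)
Lemma Lambda_cst beta k a n : 0 < beta -> Lambda beta k (fun=> a) n = a.
Proof.
move=> beta0; have [y _] := Lambda_powR k 0 n beta0.
under eq_fun do rewrite oppr0 powRr0.
rewrite subr0 oppr0 powRr0 mulr1 falling_fact divff; last first.
  by rewrite pnatr_eq0 -lt0n fact_gt0.
by move=> E; have := LambdaZ beta k a (fun=> 1) n; rewrite E !mulr1.
Qed.

(** Triangle inequality only: the weights cost a factor of order [x ^ k]. A bound on [u] from [N] on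
    suffices, since the transform at [n] reads only indices [>= n]. *)
Lemma Lambda_norm_le beta k u (N : nat) a B : 0 < beta -> 0 <= a ->
  (forall m, (N <= m)%N -> `|u m| <= B * (beta + m%:R) `^ (- a)) ->
  exists2 C, 0 <= C &
    forall n, (N <= n)%N ->
      `|Lambda beta k u n| <= C * (beta + n%:R) `^ (k%:R - a).
Proof.
move=> beta0 a0 uB; have xpos (n : nat) : 0 < beta + n%:R by rewrite ltr_wpDr.
have B0 : 0 <= B.
  have := le_trans (normr_ge0 _) (uB N (leqnn N)).
  by rewrite pmulr_lge0// powR_gt0.
(* Chosen so that [x + j <= D * x] whenever [x >= beta] and [j <= k]. *)
pose D := 1 + k%:R / beta.
have D0 : 0 <= D by rewrite addr_ge0// divr_ge0// ltW.
exists (\sum_(0 <= j < k.+1) D ^+ k * B) => [|n Nn].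
  by apply: sumr_ge0 => j _; rewrite mulr_ge0// exprn_ge0.
rewrite /Lambda normrM normrX normrN1 expr1n mul1r.
rewrite (le_trans (ler_norm_sum _ _ _))// mulr_suml.
apply: ler_sum_nat => j /andP[_]; rewrite ltnS => jk.
rewrite gt0_powRD// powR_mulrn ?(ltW (xpos n))//.
rewrite !normrM normrX normrN1 expr1n mul1r mulrACA -exprMn.
apply: ler_pM => //.
- rewrite -[leRHS]mulr1 normfV ger0_norm; last first.
    by rewrite exprn_ge0// addr_ge0// ltW.
  apply: ler_pM => //.
  + by rewrite exprn_ge0// addr_ge0// ltW.
  + rewrite lerXn2r ?nnegrE ?addr_ge0 ?mulr_ge0 ?(ltW (xpos n)) ?(ltW beta0)//.
    rewrite /D mulrDl mul1r lerD2l (@le_trans _ _ (k%:R / beta * beta))//.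
      by rewrite divfK ?gt_eqF// ler_nat.
    by rewrite ler_wpM2l ?divr_ge0 ?(ltW beta0)// lerDl.
  + rewrite ger0_norm// invf_le1 ?mulr_gt0 ?ltr0n ?fact_gt0//.
    by rewrite -natrM ler1n muln_gt0 !fact_gt0.
- rewrite (le_trans (uB _ (leq_trans Nn (leq_addr _ _))))//.
  rewrite ler_wpM2l// !powRN lef_pV2 ?posrE ?powR_gt0//.
  rewrite ge0_ler_powR ?nnegrE ?(ltW (xpos _))//.
  by rewrite lerD2l ler_nat leq_addr.
Qed.

End LambdaTheory.

(** * Uniform tail estimate for the series *)

Section DirichletTail.
Variable R : realType.
Implicit Types (alpha beta x : R) (c : nat -> R).

Lemma sum_expr_le (q : R) n : 0 <= q <= 2^-1 -> \sum_(i < n) q ^+ i <= 2.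
Proof.
move=> /andP[q0 q2]; have := subrX1 q n => E.
have S0 : 0 <= \sum_(i < n) q ^+ i by apply: sumr_ge0 => i _; exact: exprn_ge0.
have qn : 0 <= q ^+ n by exact: exprn_ge0.
(* If [S] is the sum, then [S / 2 <= (1 - q) * S = 1 - q ^ n <= 1]. *)
by nra.
Qed.

(** Convergence at [beta] bounds the terms there. Moving to [x >= 2 * beta] multiplies the [j]-th
    term by a fixed factor times [(beta / x) ^ j], so the tail is dominated by a geometric one of
    ratio at most 1/2, with [B] independent of [x]. *)
Lemma dirichlet_tail_le alpha beta c J : 0 < beta ->
  cvgn (series (fun j => c j / beta `^ (alpha + j%:R))) ->
  exists B, forall x, 2 * beta <= x ->
    cvgn (series (fun j => c j / x `^ (alpha + j%:R))) ->
    `|limn (series (fun j => c j / x `^ (alpha + j%:R))) -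
      series (fun j => c j / x `^ (alpha + j%:R)) J| <=
    B * x `^ (- (alpha + J%:R)).
Proof.
move=> beta0 /cvg_series_bounded[M [_ /(_ (M + 1))]].
rewrite ltrDl ltr01 => /(_ isT) bM; set M1 := M + 1 in bM.
have M0 : 0 <= M1 by exact: le_trans (normr_ge0 _) (bM 0%N I).
(* [M1 * beta ^ (alpha + J)] bounds [|c J|]; the 2 bounds the geometric sum. *)
exists (2 * M1 * beta `^ (alpha + J%:R)) => x bx cvx.
have x0 : 0 < x by apply: lt_le_trans bx; rewrite mulr_gt0.
pose q := beta / x.
have q0 : 0 <= q by rewrite divr_ge0// ltW.
have q2 : q <= 2^-1 by rewrite /q ler_pdivrMr// mulrC ler_pdivlMr// mulrC.
have pq (p : R) j : beta `^ (p + j%:R) / x `^ (p + j%:R) =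
    beta `^ p / x `^ p * q ^+ j.
  rewrite !gt0_powRD// !powR_mulrn ?(ltW x0) ?(ltW beta0)//.
  by rewrite /q expr_div_n invfM mulrACA.
have cj j : `|c j / x `^ (alpha + j%:R)| <=
    M1 * (beta `^ alpha / x `^ alpha * q ^+ j).
  rewrite -pq mulrA normrM normfV (ger0_norm (powR_ge0 _ _)).
  rewrite ler_wpM2r// ?invr_ge0 ?powR_ge0//.
  have := bM j I; rewrite /= normrM normfV (ger0_norm (powR_ge0 _ _)).
  by rewrite ler_pdivrMr ?powR_gt0.
set f := series _ in cvx *.
(* It is enough to bound the finite sections [f N - f J] uniformly in [N] and pass to the limit. *)
have fcvg : `|f N - f J| @[N --> \oo] --> `|limn f - f J|.
  by apply: cvg_norm; apply: cvgB => //; exact: cvg_cst.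
apply: (cvgr_to_le fcvg); near=> N.
have JN : (J <= N)%N by near: N; exact: nbhs_infty_ge.
rewrite /f sub_series_geq// (le_trans (ler_norm_sum _ _ _))//.
rewrite (le_trans (ler_sum _ (fun j _ => cj j)))//.
have -> : 2 * M1 * beta `^ (alpha + J%:R) * x `^ (- (alpha + J%:R)) =
    M1 * (beta `^ alpha / x `^ alpha * (q ^+ J * 2)).
  by rewrite powRN -(mulrA (2 * M1)) pq; ring.
rewrite -mulr_sumr ler_wpM2l// -mulr_sumr ler_wpM2l//.
  by rewrite divr_ge0 ?powR_ge0.
rewrite -{1}[J]add0n big_addn big_mkord.
under eq_bigr do rewrite exprD mulrC.
by rewrite -mulr_sumr ler_wpM2l ?exprn_ge0// sum_expr_le// q0.
Unshelve. all: by end_near. Qed.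

End DirichletTail.

Lemma Lambda0 (R : realType) (beta : R) u n : Lambda beta 0 u n = u n.
Proof. by rewrite /Lambda big_nat1 !fact0 !expr0 addn0 !mulr1 divr1 !mul1r. Qed.

(** * Asymptotics of the transformed sequence *)

Section LogConvergent.
Variables (R : realType) (alpha beta s : R) (c sn : nat -> R).
Hypotheses (alpha0 : 0 < alpha) (beta0 : 0 < beta).
Hypothesis cvg_sn : forall n : nat,
  cvgn (series (fun j => c j / (beta + n%:R) `^ (alpha + j%:R))).
Hypothesis snE : forall n : nat,
  sn n = s + limn (series (fun j => c j / (beta + n%:R) `^ (alpha + j%:R))).

Let x (n : nat) := beta + n%:R.

Let x_gt0 n : 0 < x n. Proof. by rewrite ltr_wpDr. Qed.

Let Lpow k j := Lambda beta k (fun m => x m `^ (- (alpha + j%:R))).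

Let rem J n := limn (series (fun j => c j / x n `^ (alpha + j%:R))) -
  series (fun j => c j / x n `^ (alpha + j%:R)) J.

Let Lambda_sn k J n : Lambda beta k sn n - s =
  \sum_(0 <= j < J) c j * Lpow k j n + Lambda beta k (rem J) n.
Proof.
have -> : sn = fun m =>
    s + (\sum_(0 <= j < J) c j * x m `^ (- (alpha + j%:R)) + rem J m).
  apply/funext => m; rewrite snE; congr (_ + _).
  by under eq_bigr do rewrite powRN; rewrite [RHS]addrC subrK.
rewrite (LambdaD beta k (fun=> s)) Lambda_cst// addrAC subrr add0r.
pose F j m := c j * x m `^ (- (alpha + j%:R)).
rewrite (LambdaD beta k (fun m => \sum_(0 <= j < J) F j m)) Lambda_sum.
congr (_ + _); apply: eq_bigr => j _; exact: LambdaZ.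
Qed.

(** The truncation index [2 * k + 1] absorbs the factor [x ^ k] lost in the crude bound: [k - (alpha
    + 2 * k + 1) = - (alpha + k + 1)]. *)
Let Lambda_rem k : exists C N, forall n, (N <= n)%N ->
  `|Lambda beta k (rem (2 * k + 1)) n| <= C * x n `^ (- (alpha + k.+1%:R)).
Proof.
have cvg0 : cvgn (series (fun j => c j / beta `^ (alpha + j%:R))).
  by have := @cvg_sn 0%N; rewrite addr0.
have [B xB] := dirichlet_tail_le (2 * k + 1) beta0 cvg0.
(* From this index on [m >= beta], so that [beta + m >= 2 * beta] as the tail estimate demands. *)
pose N := (Num.truncn beta).+1.
have [|C _ CP] := @Lambda_norm_le R beta k (rem (2 * k + 1)) N
    (alpha + (2 * k + 1)%:R) B beta0 (addr_ge0 (ltW alpha0) (ler0n _ _)).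
  move=> m Nm; apply: xB; last exact: cvg_sn.
  rewrite mulrDl mul1r lerD2l.
  by rewrite (le_trans (ltW (truncnS_gt _)))// ler_nat.
exists C, N => n /CP; congr (_ <= C * x n `^ _).
by rewrite natrD natrM -natr1; ring.
Qed.

Let cvg_inv : (x n)^-1 @[n --> \oo] --> (0 : R).
Proof.
apply/gtr0_cvgV0; first by near=> n; exact: x_gt0.
apply/cvgryPge => A; near=> n.
apply: (@le_trans _ _ n%:R); last by rewrite lerDr ltW.
by near: n; exact: nbhs_infty_ger.
Unshelve. all: by end_near. Qed.

(** The intermediate points from the mean value theorem are harmless: [y / x] lies between 1 and
    [1 + k / x], and [z ^ (- a)] is continuous at 1. *)
Let cvg_shifted k (y : nat -> R) a :
  (forall n, x n <= y n <= x n + k%:R) ->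
  y n `^ (- a) * x n `^ a @[n --> \oo] --> (1 : R).
Proof.
move=> xyk.
have cvgyx : y n / x n @[n --> \oo] --> (1 : R).
  apply: (@squeeze_cvgr _ _ _ _ (cst 1) (fun n => 1 + k%:R * (x n)^-1)).
  - near=> n; rewrite /= ler_pdivlMr// mul1r ler_pdivrMr// mulrDl mul1r.
    by rewrite divfK ?gt_eqF.
  - exact: cvg_cst.
  - rewrite -[X in _ --> X]addr0 -(mulr0 k%:R).
    by apply: cvgD; [exact: cvg_cst|apply: cvgMl_tmp].
have cont : {for 1, continuous (fun z : R => z `^ (- a))}.
  apply/differentiable_continuous/derivable1_diffP.
  by apply: derivable_powR; rewrite in_itv/= ltr01.
have := cvg_comp _ _ cvgyx cont; rewrite /= powR1.
apply: cvg_trans; apply: near_eq_cvg; near=> n => /=.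
have /andP[xyn _] := xyk n.
have y0 : 0 < y n by exact: lt_le_trans xyn.
by rewrite powRM ?invr_ge0 ?ltW// -powR_inv1 ?ltW// -powRrM mulN1r opprK.
Unshelve. all: by end_near. Qed.

Let cvg_powN j : (0 < j)%N -> x n `^ (- j%:R) @[n --> \oo] --> (0 : R).
Proof.
case: j => // j _; rewrite -[X in _ --> X](expr0n R j.+1).
under eq_fun do rewrite powR_invn ?ltW// -exprVn.
exact: (cvg_comp _ _ cvg_inv (@exprn_continuous R j.+1 0)).
Qed.

(** After scaling by [x ^ alpha] a factor [x ^ (- j)] is left over, so only the leading term [j = 0]
    survives in the limit. *)
Let cvg_Lpow k j : Lpow k j n * x n `^ alpha @[n --> \oo] -->
  if j == 0%N then falling (k%:R - alpha) k / k`!%:R else (0 : R).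
Proof.
have /choice[y yP] : forall n, exists y, x n <= y <= x n + k%:R /\
    Lpow k j n = falling (k%:R - (alpha + j%:R)) k / k`!%:R *
      y `^ (- (alpha + j%:R)).
  by move=> n; have [y yx yE] := Lambda_powR k (alpha + j%:R) n beta0; exists y.
have yx n : x n <= y n <= x n + k%:R by have [] := yP n.
set b := falling _ _ / _ in yP.
have -> : (fun n => Lpow k j n * x n `^ alpha) = (fun n => b *
    (y n `^ (- (alpha + j%:R)) * x n `^ (alpha + j%:R) * x n `^ (- j%:R))).
  apply/funext => n; have [_ ->] := yP n.
  by rewrite -!mulrA -gt0_powRD// addrK.
have lim := cvg_shifted (alpha + j%:R) yx.
have [j0|j0] := eqVneq j 0%N.
  rewrite (_ : falling _ _ / _ = b * (1 * 1)); last first.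
    by rewrite /b j0 addr0 !mulr1.
  apply: cvgMl_tmp; apply: cvgM => //; rewrite j0 oppr0.
  by under eq_fun do rewrite powRr0; exact: cvg_cst.
rewrite -(mulr0 b) -[X in b * X](mul1r 0).
by apply: cvgMl_tmp; apply: cvgM => //; apply: cvg_powN; rewrite lt0n.
Qed.

Let cvg_Lambda_sn k : (Lambda beta k sn n - s) * x n `^ alpha @[n --> \oo] -->
  c 0%N * (falling (k%:R - alpha) k / k`!%:R).
Proof.
have [C [N CP]] := Lambda_rem k.
have -> : (fun n => (Lambda beta k sn n - s) * x n `^ alpha) = (fun n =>
    \sum_(0 <= j < 2 * k + 1) c j * (Lpow k j n * x n `^ alpha) +
    Lambda beta k (rem (2 * k + 1)) n * x n `^ alpha).
  apply/funext => n; rewrite (Lambda_sn k (2 * k + 1)) mulrDl mulr_suml.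
  by congr (_ + _); apply: eq_bigr => j _; rewrite mulrA.
rewrite -[X in _ --> X]addr0; apply: cvgD; last first.
  apply: norm_cvg0.
  have : C * x n `^ (- k.+1%:R) @[n --> \oo] --> (0 : R).
    by rewrite -(mulr0 C); apply: cvgMl_tmp; exact: cvg_powN.
  apply: squeeze_cvgr (cvg_cst 0); near=> n; rewrite normr_ge0/=.
  rewrite normrM (ger0_norm (powR_ge0 _ _)).
  have -> : C * x n `^ (- k.+1%:R) =
      C * x n `^ (- (alpha + k.+1%:R)) * x n `^ alpha.
    by rewrite -mulrA -gt0_powRD// opprD addrAC addNr add0r.
  by rewrite ler_wpM2r ?powR_ge0// CP//; near: n; exact: nbhs_infty_ge.
rewrite [X in _ --> X](_ : _ = \sum_(0 <= j < 2 * k + 1) c j *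
    if j == 0%N then falling (k%:R - alpha) k / k`!%:R else 0); last first.
  rewrite addn1 big_nat_recl// big1 ?addr0// => j _.
  by rewrite mulr0.
apply: cvg_big => [|j _]; first exact: add_continuous.
by apply: cvgMl_tmp; exact: cvg_Lpow.
Unshelve. all: by end_near. Qed.

Lemma cvg_ratio k : c 0%N != 0 ->
  (Lambda beta k sn n - s) / (sn n - s) @[n --> \oo] -->
  falling (k%:R - alpha) k / k`!%:R.
Proof.
move=> c0; set b := falling _ _ / _.
(* For [k = 0] the transformation is the identity and the falling factorial is an empty product, so
   the denominator is a special case of the numerator. *)
have den : (sn n - s) * x n `^ alpha @[n --> \oo] --> c 0%N.
  have := @cvg_Lambda_sn 0%N.
  rewrite /falling big_geq// fact0 invr1 !mulr1.
  by have -> : Lambda beta 0 sn = sn by apply/funext => n; exact: Lambda0.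
have : (Lambda beta k sn n - s) * x n `^ alpha / ((sn n - s) * x n `^ alpha)
    @[n --> \oo] --> c 0%N * b / c 0%N.
  by apply: cvgM; [exact: cvg_Lambda_sn|exact: cvgV].
rewrite mulrAC divff// mul1r; apply: cvg_trans.
apply: near_eq_cvg; near=> n => /=.
by rewrite invfM mulrACA divff ?mulr1// gt_eqF// powR_gt0.
Unshelve. all: by end_near. Qed.

(** If [p + j <= k], then [k - (p + j)] is a natural number below [k] and the coefficient vanishes.
    Otherwise the exponent is at most [- (k + 1)], and [1 <= x <= y] gives the bound. *)
Let Lpow_le k j (p : nat) n : alpha = p%:R -> (0 < p)%N -> 1 <= x n ->
  `|Lpow k j n| <=
  `|falling (k%:R - (alpha + j%:R)) k / k`!%:R| * x n `^ (- k.+1%:R).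
Proof.
move=> pE p0 x1.
have [y /andP[xy _] E] := Lambda_powR k (alpha + j%:R) n beta0.
have y1 : 1 <= y by exact: le_trans xy.
rewrite /Lpow E normrM (ger0_norm (powR_ge0 _ _)).
have [pjk|kpj] := leqP (p + j) k.
  have -> : falling (k%:R - (alpha + j%:R)) k = 0.
    rewrite pE -natrD -natrB// falling_nat_eq0// ltn_subrL addn_gt0 p0/=.
    by rewrite (leq_trans _ pjk)// addn_gt0 p0.
  by rewrite mul0r normr0 !mul0r.
rewrite ler_wpM2l// (@le_trans _ _ (y `^ (- k.+1%:R)))//.
  by rewrite ler_powR// lerN2 pE -natrD ler_nat.
have y0 : 0 < y by exact: lt_le_trans y1.
rewrite !powRN lef_pV2 ?posrE ?powR_gt0//.
by rewrite ge0_ler_powR ?nnegrE ?(ltW (x_gt0 n)) ?(ltW y0).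
Qed.

Lemma Lambda_bigO k : alpha \is a Num.int -> alpha <= k%:R ->
  (fun n => Lambda beta k sn n - s) =O_\oo (fun n => (n%:R : R) ^- k.+1).
Proof.
move=> alphaZ alphak.
have /natrP[p pE] : alpha \is a Num.nat by rewrite natrEint alphaZ ltW.
have p0 : (0 < p)%N by rewrite -(ltr0n R) -pE.
have [C [N CP]] := Lambda_rem k.
set D := \sum_(0 <= j < 2 * k + 1)
  `|c j| * `|falling (k%:R - (alpha + j%:R)) k / k`!%:R|.
have D0 : 0 <= D by apply: sumr_ge0 => j _; rewrite mulr_ge0.
(* [D] serves the leading terms and [C] the remainder; the 1 makes the constant strictly
   positive. *)
apply/eqO_exP; exists (D + `|C| + 1).
  by rewrite ltr_wpDl// addr_ge0.
near=> n.
(* This excludes [n = 0], where the inverse power defaults to 0, and makes the base [x n] at least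
   1. *)
have n1 : (1 <= n)%N by near: n; exact: nbhs_infty_ge.
have x1 : 1 <= x n by rewrite (@le_trans _ _ n%:R) ?ler1n// lerDr ltW.
have nx : x n `^ (- k.+1%:R) <= `|n%:R ^- k.+1|.
  rewrite powR_invn ?(ltW (x_gt0 n))// ger0_norm ?invr_ge0 ?exprn_ge0//.
  rewrite lef_pV2 ?posrE ?exprn_gt0 ?ltr0n//.
  by rewrite lerXn2r ?nnegrE ?(ltW (x_gt0 n))// lerDr ltW.
apply: (@le_trans _ _ ((D + `|C|) * x n `^ (- k.+1%:R))); last first.
  by apply: ler_pM => //; rewrite ?powR_ge0 ?addr_ge0// lerDl.
rewrite (Lambda_sn k (2 * k + 1)) (le_trans (ler_normD _ _))// mulrDl lerD//.
  rewrite (le_trans (ler_norm_sum _ _ _))// /D mulr_suml ler_sum// => j _.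
  by rewrite normrM -mulrA ler_wpM2l// (Lpow_le _ _ pE).
have Nn : (N <= n)%N by near: n; exact: nbhs_infty_ge.
rewrite (le_trans (CP n Nn))//.
rewrite (@le_trans _ _ (`|C| * x n `^ (- (alpha + k.+1%:R))))//.
  by rewrite ler_wpM2r ?powR_ge0// ler_norm.
by rewrite ler_wpM2l// ler_powR// lerN2 lerDr ltW.
Unshelve. all: by end_near. Qed.

End LogConvergent.

Theorem mainTheorem6 (R : realType) (alpha beta s : R) (c sn : nat -> R)
    (halpha : 0 < alpha) (hbeta : 0 < beta) (hc0 : c 0%N != 0)
    (hcvg : forall n : nat,
       cvgn (series (fun j => c j / (beta + n%:R) `^ (alpha + j%:R))))
    (hsn : forall n : nat,
       sn n = s + limn (series
         (fun j => c j / (beta + n%:R) `^ (alpha + j%:R)))) :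
  (alpha \is a Num.int ->
     forall k : nat, (0 < k)%N -> alpha <= k%:R ->
       (fun n => Lambda beta k sn n - s) =O_\oo (fun n => (n%:R : R) ^- k.+1)
       /\ accelerates (Lambda beta k sn) sn s)
  /\
  (alpha \isn't a Num.int ->
     forall k : nat, (0 < k)%N -> ~ accelerates (Lambda beta k sn) sn s).
Proof.
have ratio k :=
  @cvg_ratio R alpha beta s c sn halpha hbeta hcvg hsn k hc0.
split=> [alphaZ k _ alphak | alphaNZ k _ acc].
  split; first exact: (Lambda_bigO halpha hbeta hcvg hsn alphaZ alphak).
  have /natrP[p pE] : alpha \is a Num.nat by rewrite natrEint alphaZ ltW.
  rewrite /accelerates; have := @ratio k.
  rewrite pE ler_nat in alphak *; rewrite -natrB// falling_nat_eq0 ?mul0r//.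
  have p0 : (0 < p)%N by rewrite -(ltr0n R) -pE.
  (* Positivity of [p] gives [k - p < k], so the product contains a zero factor. *)
  by rewrite ltn_subrL p0 (leq_trans p0).
(* Acceleration would force the limit of the ratio to be 0. Some factor [k - alpha - i] would then
   vanish, making [alpha = k - i] an integer. *)
have /eqP : falling (k%:R - alpha) k / k`!%:R = 0.
  exact: (cvg_unique _ (@ratio k) acc).
rewrite mulf_eq0 invr_eq0 pnatr_eq0 eqn0Ngt fact_gt0 orbF.
rewrite /falling big_mkord prodf_seq_eq0 => /hasP[i _ /=].
rewrite addrAC subr_eq0 => /eqP alphaE.
move/negP: alphaNZ; apply.
by rewrite -alphaE rpredB ?natr_int.
Qed.
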